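(* Let $S=3$. There is a constant $C$, not depending on $T$, such that for every integer $T\geq 3$ the polytope $P_{3,T}$ (the convex hull of the columns of the design matrix $A_{3,T}$ of the toric homogeneous Markov chain model without initial parameters and without self-loops) has at most $C$ vertices.
   Context: For positive integers $S,T$ let $[S]=\{1,\dots,S\}$, and let $[S]^T_{NL}$ be the set of words $w=(s_1,\dots,s_T)$ with $s_t\in[S]$ and $s_t\neq s_{t+1}$ for $t=1,\dots,T-1$. The design matrix $A_{S,T}$ of the model without initial parameters and without self-loops is the $S(S-1)\times S(S-1)^{T-1}$ integer matrix with rows indexed by pairs $(i,j)\in[S]^2$ with $i\neq j$ and columns indexed by words in $[S]^T_{NL}$, whose entry in row $(i,j)$ and column $w=(s_1,\dots,s_T)$ is the number of indices $t\in\{1,\dots,T-1\}$ with $(s_t,s_{t+1})=(i,j)$. The polytope $P_{S,T}\subset\mathbb{R}^{S(S-1)}$ is the convex hull of the columns of $A_{S,T}$. *)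

(* Defs.v *)
From mathcomp Require Import all_boot all_order all_algebra.
From mathcomp Require Import classical_sets cardinality reals convex.

Set Implicit Arguments.
Unset Strict Implicit.
Unset Printing Implicit Defensive.

Import Order.TTheory GRing.Theory Num.Theory.

Local Open Scope classical_set_scope.
Local Open Scope ring_scope.

(* States are numbered 0, ..., S - 1 instead of 1, ..., S. *)
Definition transitions (S : nat) : {set 'I_S * 'I_S} :=
  [set p | p.1 != p.2]%SET.

Definition loopless_words (S T : nat) : {set T.-tuple 'I_S} :=
  [set w : T.-tuple 'I_S | sorted (fun i j => i != j) w]%SET.

(* zip truncates to the shorter list, so this is
   [:: (s_1, s_2); ...; (s_(T-1), s_T)]. *)
Definition steps (S : nat) (w : seq 'I_S) : seq ('I_S * 'I_S) :=
  zip w (behead w).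

(* Rows and columns are numbered by the canonical enumerations of
   transitions S and loopless_words S T. *)
Definition design_matrix (S T : nat) :
    'M[int]_(#|transitions S|, #|loopless_words S T|) :=
  \matrix_(r < #|transitions S|, c < #|loopless_words S T|)
    (count_mem (enum_val r) (steps (enum_val c)))%:Z.

Definition convex_hull (R : realType) (n : nat) (A : set 'cV[R]_n) :
    set 'cV[R]_n :=
  smallest (@convex_set R 'cV[R]_n) A.

Definition design_polytope (R : realType) (S T : nat) :
    set 'cV[R]_#|transitions S| :=
  convex_hull
    (range (fun c => col c (map_mx (fun z : int => z%:~R) (design_matrix S T)))).
Arguments design_polytope R S T : clear implicits.

Definition face (R : realType) (n : nat) (P F : set 'cV[R]_n) : Prop :=
  exists (a : 'rV[R]_n) (b : R),
    (forall x, P x -> (a *m x) 0 0 <= b) /\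
    F = [set x | P x /\ (a *m x) 0 0 = b].

(* Vertices are the zero-dimensional faces, i.e. the singleton faces. *)
Definition vertices (R : realType) (n : nat) (P : set 'cV[R]_n) :
    set 'cV[R]_n :=
  [set v | face P [set v]].

Lemma card_transitions (S : nat) : #|transitions S| = (S * S.-1)%N.
Proof.
rewrite cardsE.
have -> : #|[pred p : 'I_S * 'I_S | p.1 != p.2]|
        = (#|{: 'I_S * 'I_S}| - #|[pred p : 'I_S * 'I_S | p.1 == p.2]|)%N.
  rewrite -(cardC [pred p : 'I_S * 'I_S | p.1 == p.2]) addKn.
  by apply: eq_card => p; rewrite !inE.
have -> : #|[pred p : 'I_S * 'I_S | p.1 == p.2]| = S.
  rewrite -[RHS](card_ord S).
  rewrite -(card_codom (f := fun i : 'I_S => (i, i))); last by move=> i j [].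
  apply: eq_card => -[i j]; rewrite !inE /=.
  by apply/eqP/codomP => [->|[k [-> ->]]] //; exists j.
by rewrite card_prod card_ord -subn1 mulnBr muln1.
Qed.

(* Main.v *)
Require Import Defs.
From mathcomp Require Import all_boot all_order all_algebra.
From mathcomp Require Import classical_sets cardinality reals.
From mathcomp Require Import boolp interval_inference convex.
From mathcomp Require Import zify.

(** Only the numbers of steps matter, so closed walks contained in a word can be
    moved and exchanged freely. Erasing loops from left to right, while keeping
    one visit to each letter, splits the steps of a word into those of a base
    word of length at most (S+1)^2 and those of closed walks of length at most S
    that start at a letter of the base ([loop_erasure]). Conversely every
    multiset of such closed walks can be inserted into the base
    ([insert_closed_walks]).

    Let v be a vertex, that is, the only maximizer of some linear form on the
    polytope. It is a column of the matrix ([vertex_in_generators]), so it comes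
    from a word. Suppose that the closed walks c and c', of lengths l and l',
    both occur at least S times in its decomposition. Then l' copies of c can
    be traded for l copies of c', or the other way round, without changing the
    total length. One of the two trades does not decrease the linear form, so by
    uniqueness of the maximizer it does not move v: the vectors counting the
    steps of c and of c' are in the ratio l : l' ([heavy_walks_parallel]).

    Consequently the part of v carried by the copies beyond the first S of each
    closed walk is a multiple of one vector, and its factor is forced by the
    total number T - 1 of steps. So v is determined by the base and by the
    multiplicities truncated at S ([vertices_decoded]), which leaves a number of
    possibilities that does not depend on T. *)

Set Implicit Arguments.
Unset Strict Implicit.
Unset Printing Implicit Defensive.

Import Order.TTheory GRing.Theory Num.Theory.

Local Open Scope classical_set_scope.
Local Open Scope card_scope.

(** * Sums over sequences with multiplicities *)

Lemma perm_extract (I : eqType) (x : I) k (s : seq I) : (k <= count_mem x s)%N ->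
  exists s', perm_eq s (nseq k x ++ s').
Proof.
move=> ks; exists (nseq (count_mem x s - k) x ++ filter (predC1 x) s).
rewrite catA -nseqD subnKC // -size_filter perm_sym.
by rewrite -(all_pred1P _ _ (filter_all _ _)); apply/permEl/perm_filterC.
Qed.

Lemma natmul_nat (k l : nat) : (k *+ l)%R = (k * l)%N.
Proof. by elim: l => [|l IH]; rewrite ?muln0 // mulrS mulnS IH. Qed.

Lemma sum_count (V : nmodType) (I : finType) (F : I -> V) (s : seq I) :
  (\sum_(x <- s) F x = \sum_x F x *+ count_mem x s)%R.
Proof.
elim: s => [|y s IH]; first by rewrite big_nil big1.
rewrite big_cons IH; under [RHS]eq_bigr do rewrite /= mulrnDr.
rewrite big_split; congr (_ + _)%R; rewrite (bigD1 y) //= eqxx big1 ?addr0 //.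
by move=> x /negPf xy; rewrite eq_sym xy.
Qed.

(** * Splitting words into closed walks and a bounded base *)

Section Words.
Variable S : nat.
Implicit Types (a s : 'I_S) (b p q u v w : seq 'I_S).

Notation neq := (fun i j : 'I_S => i != j).

(** The steps of the closed walk that runs through [c] and returns to its first
    letter. *)
Definition arcs (c : seq 'I_S) := zip c (rot 1 c).
Arguments arcs : simpl never.

Lemma size_arcs (c : seq 'I_S) : size (arcs c) = size c.
Proof. by rewrite size1_zip // size_rot. Qed.

Lemma size_steps w : size (steps w) = (size w).-1.
Proof. by rewrite /steps size_zip size_behead; apply/minn_idPr/leq_pred. Qed.

Lemma steps_cat_cons u a v :
  steps (u ++ a :: v) = steps (rcons u a) ++ steps (a :: v).
Proof.
rewrite /steps; elim: u => [|x u IH] /=; first by [].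
by case: u IH => [//|y u] /= ->.
Qed.

Lemma steps_arcs a p : steps (a :: rcons p a) = arcs (a :: p).
Proof.
rewrite /steps /arcs rot1_cons /=.
have zip_rcons q r : size r = size q -> zip (rcons q a) r = zip q r.
  by elim: q r => [|y q IH] [|z r] //= [/IH->].
by rewrite -rcons_cons zip_rcons // size_rcons.
Qed.

Lemma perm_steps_insert u a p v :
  perm_eq (steps (u ++ a :: p ++ a :: v))
    (arcs (a :: p) ++ steps (u ++ a :: v)).
Proof.
rewrite steps_cat_cons -cat_cons steps_cat_cons rcons_cons.
by rewrite steps_arcs perm_catCA (steps_cat_cons u a v).
Qed.

Lemma sorted_insert u a p v :
  sorted neq (u ++ a :: p ++ a :: v) =
    sorted neq (u ++ a :: v) && cycle neq (a :: p).
Proof.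
rewrite !sorted_cat_cons -cat_rcons cat_path last_rcons /=.
by rewrite -!andbA; congr andb; rewrite andbC.
Qed.

(** A closed walk whose first letter occurs in [b] can be spliced into [b], and
    into every word that visits at least the letters of [b]. *)
Definition rooted b (c : seq 'I_S) :=
  if c is a :: _ then (a \in b) && cycle neq c else false.

Definition all_rooted b (cs : seq (S.-bseq 'I_S)) :=
  all (fun c : S.-bseq 'I_S => rooted b c) cs.

(** The order of the steps is forgotten, since the design matrix only counts
    them. *)
Definition decomposes w b (cs : seq (S.-bseq 'I_S)) :=
  perm_eq (steps w)
    (flatten [seq arcs c | c : S.-bseq 'I_S <- cs] ++ steps b).

(** Insertion only enlarges the set of visited letters, so the closed walks can
    be inserted one after the other, in any number and any order: no
    connectivity condition limits the multiplicities. *)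
Lemma insert_closed_walks b (cs : seq (S.-bseq 'I_S)) :
    sorted neq b -> all_rooted b cs ->
  exists2 w, sorted neq w & decomposes w b cs.
Proof.
move=> sb; suff: all_rooted b cs ->
    exists w, [/\ sorted neq w, {subset b <= w} & decomposes w b cs].
  by move=> H /H [w [sw _ pw]]; exists w.
rewrite /all_rooted /decomposes.
elim: cs => [|c cs IH] /=; first by exists b; split.
case: c => -[|a p] // sz /andP[/andP[ab cyc]] /IH[w [sw bw pw]].
have aw := bw a ab; case/splitPr: aw sw bw pw => u v sw bw pw.
exists (u ++ a :: p ++ a :: v); split.
- by rewrite sorted_insert sw.
- move=> x /bw; rewrite !(mem_cat, inE).
  by case/or3P => ->; rewrite ?orbT.
- rewrite (perm_trans (perm_steps_insert _ _ _ _)) // -catA perm_cat2l.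
  exact: pw.
Qed.

(** The word is read from left to right. The part already reduced is [u ++ p],
    where [u] contains all letters seen so far, and [p] has no repeated letter.
    A letter unseen so far moves everything to [u], which happens at most [S]
    times and adds at most [S.+1] letters each time. A letter that occurs in
    [p] closes a walk of length at most [S]; deleting it from [p] loses no
    visited letter because [u] keeps them all. *)
Lemma erase_loops u p v :
    uniq p -> {subset p <= u} -> (size u <= S.+1 * #|u|)%N ->
    sorted neq (u ++ p ++ v) ->
  exists b (cs : seq (S.-bseq 'I_S)),
    [/\ {subset u <= b}, (size b <= S.+1 * S.+1)%N, sorted neq b,
        all_rooted b cs
      & decomposes (u ++ p ++ v) b cs].
Proof.
have usize q : uniq q -> (size q <= S)%N.
  by move=> uq; rewrite -[leqRHS]card_ord -(card_uniqP uq) max_card.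
rewrite /decomposes; elim: v u p => [|s v IH] u p up pu su sw.
  exists (u ++ p), [::]; rewrite cats0 in sw *; split=> //.
  - by move=> x xu; rewrite mem_cat xu.
  - rewrite size_cat mulnS addnC leq_add //; first by rewrite ltnW // ltnS usize.
    by apply: leq_trans su _; rewrite leq_mul2l -[leqRHS]card_ord max_card.
case: (boolP (s \in u)) => [s_u|s_new]; last first.
  have [||||b [cs [ub]]] := IH (rcons (u ++ p) s) [::] => //.
  - rewrite size_rcons size_cat.
    have: (#|u| < #|rcons (u ++ p) s|)%N.
      apply: proper_card; rewrite properE; apply/andP; split.
        by apply/fintype.subsetP => x xu; rewrite mem_rcons inE mem_cat xu orbT.
      by apply/fintype.subsetPn; exists s; rewrite // mem_rcons mem_head.
    move/(leq_mul (leqnn S.+1)); apply: leq_trans.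
    by rewrite mulnS addnC -addSn leq_add // ltnS usize.
  - by rewrite cat_rcons -catA.
  - rewrite cat_rcons -catA => ? ? ? ?; exists b, cs; split=> // x xu.
    by apply: ub; rewrite mem_rcons inE mem_cat xu orbT.
have [s_p|s_p] := boolP (s \in p); last first.
  have := IH u (rcons p s); rewrite cat_rcons; apply=> //.
    by rewrite rcons_uniq s_p.
  by move=> x; rewrite mem_rcons inE => /predU1P[->|/pu].
case/splitPr: s_p up pu sw => p1 p2 up pu.
rewrite -(catA p1) (catA u) cat_cons => /[dup] sw.
rewrite sorted_insert => /andP[sw' cyc].
have [||||b [cs [ub zb sb acs pb]]] := IH u (rcons p1 s) => //.
- by move: up; rewrite -cat_rcons cat_uniq => /andP[].
- by move=> x xp; apply: pu; rewrite -cat_rcons mem_cat xp.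
- by rewrite cat_rcons catA.
have sz : (size (s :: p2) <= S)%N.
  by apply: usize; move: up; rewrite cat_uniq => /and3P[].
exists b, (Bseq sz :: cs); split=> //.
- by apply/andP; split=> //; rewrite /rooted /= ub.
- apply: perm_trans (perm_steps_insert _ _ _ _) _.
  by rewrite -(catA u) /= -(catA (arcs _)) perm_cat2l -cat_rcons.
Qed.

(** The base [b] ranges over a finite set that does not depend on the length of
    [w]; all the length is in the multiplicities of the closed walks. *)
Lemma loop_erasure w : sorted neq w ->
  exists b (cs : seq (S.-bseq 'I_S)),
    [/\ (size b <= S.+1 * S.+1)%N, sorted neq b,
        all_rooted b cs & decomposes w b cs].
Proof.
move=> sw; have [||||b [cs [_ zb sb acs pb]]] := @erase_loops [::] [::] w => //.
by exists b, cs.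
Qed.

End Words.

Local Open Scope ring_scope.

(** * Vertices of the design polytope *)

Section Vertices.
Variables (R : realType) (S : nat).
Notation neq := (fun i j : 'I_S => i != j).
Notation cV := 'cV[R]_#|transitions S|.

Definition tally (s : seq ('I_S * 'I_S)) : cV :=
  \col_r (count_mem (enum_val r) s)%:R.

Lemma tally_cat s t : tally (s ++ t) = tally s + tally t.
Proof. by apply/colP => r; rewrite !mxE count_cat natrD. Qed.

Lemma perm_tally s t : perm_eq s t -> tally s = tally t.
Proof. by move=> /permP st; apply/colP => r; rewrite !mxE st. Qed.

Lemma tally_flatten (I : Type) (F : I -> seq ('I_S * 'I_S)) (cs : seq I) :
  tally (flatten [seq F c | c <- cs]) = \sum_(c <- cs) tally (F c).
Proof.
elim: cs => [|c cs IH]; last by rewrite big_cons /= tally_cat IH.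
by rewrite big_nil; apply/colP => r; rewrite !mxE.
Qed.

(** The columns are indexed by an enumeration of the words; below they are
    only used through this description. *)
Lemma design_columns T (x : cV) :
  range (fun c => col c (map_mx (fun z : int => z%:~R) (design_matrix S T))) x <->
  exists2 w, sorted neq w /\ size w = T & tally (steps w) = x.
Proof.
have colE c : col c (map_mx (fun z : int => z%:~R) (design_matrix S T))
    = tally (steps (enum_val c)).
  by apply/colP => r; rewrite !mxE.
split=> [[c _ <-]|[w [sw sz] <-]].
  exists (enum_val c); last by rewrite colE.
  split; last by rewrite size_tuple.
  by have := enum_valP c; rewrite inE.
have wT : size w == T by rewrite sz.
have lw : Tuple wT \in loopless_words S T by rewrite inE.
by exists (enum_rank_in lw (Tuple wT)) => //; rewrite colE enum_rankK_in.
Qed.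

(** A linear form that is maximal over the hull only at [v] is smaller than that
    maximum on a convex set. If [v] were not a generator, this convex set would
    contain all generators, hence the hull, hence [v]. *)
Lemma vertex_in_generators n (A : set 'cV[R]_n) (v : 'cV[R]_n) :
  vertices (convex_hull A) v -> A v.
Proof.
case=> a [b [ub Fv]].
have [Pv av] : convex_hull A v /\ (a *m v) 0 0 = b.
  by have : [set v] v by []; rewrite Fv.
have strict x : convex_hull A x -> x <> v -> (a *m x) 0 0 < b.
  move=> Px xv; rewrite lt_neqAle ub // andbT; apply/eqP => axb.
  by apply: xv; have : [set x | convex_hull A x /\ (a *m x) 0 0 = b] x by [];
    rewrite -Fv.
apply: contrapT => Av.
suff : convex_hull A `<=` [set x | convex_hull A x /\ (a *m x) 0 0 < b].
  by move=> /(_ v Pv) [_]; rewrite av ltxx.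
apply: smallest_sub => [|x Ax]; last first.
  have Px : convex_hull A x by apply: sub_gen_smallest.
  by split=> //; apply: strict => // xv; apply: Av; rewrite -xv.
apply/convex_setW => x y /set_mem[Px xb] /set_mem[Py yb] k k0 k1.
apply/mem_set; split.
  move=> Q [cQ AQ]; apply/set_mem/cQ; apply/mem_set.
    exact: Px.
  exact: Py.
have -> : (a *m (conv k x y)) 0 0
    = k%:num * (a *m x) 0 0 + (1 - k%:num) * (a *m y) 0 0.
  by rewrite mulmxDr -!scalemxAr [LHS]mxE; congr (_ + _); rewrite [LHS]mxE.
rewrite -[ltRHS]mul1r -[X in _ < X * _](subrKC k%:num 1) [ltRHS]mulrDl.
by rewrite ltrD // ltr_pM2l // subr_gt0.
Qed.

Lemma vertex_maximizes T (v : cV) : vertices (design_polytope R S T) v ->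
  exists a : 'rV[R]_#|transitions S|,
    forall w, sorted neq w -> size w = T ->
      (a *m tally (steps w)) 0 0 <= (a *m v) 0 0 ?= iff (tally (steps w) == v).
Proof.
case=> a [b [ub Fv]]; exists a => w sw sz.
have [Pv av] : design_polytope R S T v /\ (a *m v) 0 0 = b.
  by have : [set v] v by []; rewrite Fv.
have Pw : design_polytope R S T (tally (steps w)).
  by apply: sub_gen_smallest; apply/design_columns; exists w.
split; first by rewrite av ub.
apply/eqP/eqP => [aw|->//].
by rewrite av in aw; have : [set v] (tally (steps w)) by rewrite Fv.
Qed.

Definition walk_tally (b : seq 'I_S) (cs : seq (S.-bseq 'I_S)) : cV :=
  tally (steps b) + \sum_(c <- cs) tally (arcs c).

Lemma tally_walk w b (cs : seq (S.-bseq 'I_S)) :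
  decomposes w b cs ->
  tally (steps w) = walk_tally b cs.
Proof.
rewrite /decomposes => /perm_tally->.
by rewrite tally_cat tally_flatten addrC.
Qed.

Lemma walk_length w b (cs : seq (S.-bseq 'I_S)) :
  decomposes w b cs ->
  (size w).-1 = (\sum_(c <- cs) size c + size (steps b))%N.
Proof.
rewrite /decomposes => /perm_size pw; rewrite -size_steps pw size_cat.
congr (_ + _)%N => {pw}.
elim: cs => [|c cs IH]; first by rewrite big_nil.
by rewrite big_cons /= size_cat IH size_arcs.
Qed.

(** Replacing [size c] copies of [c'] by [size c'] copies of [c] keeps the length,
    so it gives another word of length [T]; this word cannot beat the vertex.
    The hypothesis [1 < T] ensures that the number of steps determines the length
    of a word. *)
Lemma trade_closed_walks (a : 'rV[R]_#|transitions S|) T (v : cV) b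
    (cs : seq (S.-bseq 'I_S)) (c c' : S.-bseq 'I_S) :
  (1 < T)%N ->
  (forall w, sorted neq w -> size w = T ->
     (a *m tally (steps w)) 0 0 <= (a *m v) 0 0 ?= iff (tally (steps w) == v)) ->
  sorted neq b -> all_rooted b cs ->
  v = walk_tally b cs -> T.-1 = (\sum_(c <- cs) size c + size (steps b))%N ->
  c \in cs -> (size c <= count_mem c' cs)%N ->
  let gain := tally (arcs c) *+ size c' - tally (arcs c') *+ size c in
  (a *m gain) 0 0 <= 0 ?= iff (gain == 0).
Proof.
move=> T1 amax sb acs ev eT ccs /perm_extract[cs0 pcs] gain.
pose cs' := nseq (size c') c ++ cs0.
have acs' : all_rooted b cs'.
  move: (acs); rewrite /all_rooted (perm_all _ pcs) all_cat => /andP[_ acs0].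
  rewrite all_cat acs0 andbT; apply/allP => d /nseqP[-> _].
  exact: (allP acs).
have [w sw pw] := insert_closed_walks sb acs'.
have sumE (V : nmodType) (F : S.-bseq 'I_S -> V) :
    \sum_(d <- cs) F d = F c' *+ size c + \sum_(d <- cs0) F d.
  by rewrite (perm_big _ pcs) big_cat big_nseq -iter_addr_0.
have sumE' (V : nmodType) (F : S.-bseq 'I_S -> V) :
    \sum_(d <- cs') F d = F c *+ size c' + \sum_(d <- cs0) F d.
  by rewrite big_cat big_nseq -iter_addr_0.
have zw : size w = T.
  have : (size w).-1 = T.-1.
    rewrite (walk_length pw) eT (sumE nat) (sumE' nat).
    by rewrite !natmul_nat mulnC.
  by case: (T) T1 => [|[|t]] //; case: (size w) => [|[|?]] //= _ [->].
have tw : tally (steps w) = v + gain.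
  rewrite (tally_walk pw) ev /walk_tally sumE sumE' /gain.
  by rewrite -addrA; congr (_ + _); rewrite addrAC subrKC.
have eqD (V : zmodType) (x y : V) : (x + y == x) = (y == 0).
  by rewrite -[LHS]subr_eq0 addrAC subrr add0r.
have := amax _ sw zw; rewrite tw mulmxDr mxE eqD => -[le_gain eq_gain].
by split; [rewrite gerDl in le_gain | rewrite -eq_gain eqD].
Qed.

(** When both walks are frequent, the trade is possible in both directions, and
    the two changes of the linear form are opposite. Both therefore vanish, and
    the maximum is attained at the vertex only. *)
Lemma heavy_walks_parallel T (v : cV) b (cs : seq (S.-bseq 'I_S)) c c' :
  (1 < T)%N -> vertices (design_polytope R S T) v ->
  sorted neq b -> all_rooted b cs ->
  v = walk_tally b cs -> T.-1 = (\sum_(c <- cs) size c + size (steps b))%N ->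
  c \in cs -> c' \in cs ->
  (S <= count_mem c cs)%N -> (S <= count_mem c' cs)%N ->
  tally (arcs c) *+ size c' = tally (arcs c') *+ size c.
Proof.
move=> T1 /vertex_maximizes[a amax] sb acs ev eT ccs c'cs nc nc'.
have trade d d' := @trade_closed_walks a T v b cs d d' T1 amax sb acs ev eT.
have [le1 eq1] := trade c c' ccs (leq_trans (size_bseq c) nc').
have [le2 _] := trade c' c c'cs (leq_trans (size_bseq c') nc).
apply/eqP; rewrite -subr_eq0 -eq1 eq_le le1 /=.
by move: le2; rewrite -opprB mulmxN mxE oppr_le0.
Qed.

(** The data [d] consist of a base and, for every closed walk, its multiplicity
    truncated at [S]. The steps not accounted for by them lie in frequent walks,
    whose tallies are proportional to their lengths; any one frequent walk [c0]
    then gives the direction of the missing summand, and [T] its coefficient. *)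
Definition decode T (d : (S.+1 * S.+1).-bseq 'I_S
                         * {ffun S.-bseq 'I_S -> 'I_S.+1}) : cV :=
  let: (b, m) := d in
  let rest :=
    (T.-1 - (\sum_(c : S.-bseq 'I_S) size c * m c + size (steps b)))%N in
  tally (steps b) + \sum_(c : S.-bseq 'I_S) tally (arcs c) *+ m c +
    (if [pick c : S.-bseq 'I_S | m c == S :> nat] is Some c0
     then (rest%:R / (size c0)%:R) *: tally (arcs c0) else 0).

Lemma vertices_decoded T : (1 < T)%N ->
  vertices (design_polytope R S T) `<=` range (decode T).
Proof.
move=> T1 v vP.
have [w [sw zw] tw] := (design_columns T v).1 (vertex_in_generators vP).
have [b [cs [zb sb acs pw]]] := loop_erasure sw.
have ev : v = walk_tally b cs by rewrite -tw (tally_walk pw).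
have eT : T.-1 = (\sum_(c <- cs) size c + size (steps b))%N.
  by rewrite -zw (walk_length pw).
pose n (c : S.-bseq 'I_S) := count_mem c cs.
pose m : {ffun S.-bseq 'I_S -> 'I_S.+1} := [ffun c => inord (minn (n c) S)].
have mE c : m c = minn (n c) S :> nat by rewrite ffunE inordK // ltnS geq_minr.
have nE c : n c = (m c + (n c - S))%N by rewrite mE minnE subnK ?leq_subr.
exists (Bseq zb, m) => //=.
rewrite ev /walk_tally (sum_count _ cs) -addrA; congr (_ + _).
rewrite [RHS](eq_bigr _ (fun c _ => congr1 (GRing.natmul _) (nE c))).
under [RHS]eq_bigr do rewrite mulrnDr.
rewrite big_split /=; congr (_ + _).
have -> : (T.-1 - (\sum_(c : S.-bseq 'I_S) size c * m c + size (steps b)))%N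
    = (\sum_(c : S.-bseq 'I_S) size c * (n c - S))%N.
  rewrite eT subnDr (sum_count (size \o val)) /=.
  rewrite (eq_bigr (fun c : S.-bseq _ => size c * m c + size c * (n c - S))%N).
    by rewrite big_split /= addKn.
  by move=> c _; rewrite natmul_nat -mulnDr -nE.
case: pickP => [c0 /eqP mc0|light]; last first.
  rewrite big1 // => c _; suff -> : (n c - S = 0)%N by [].
  have := light c; rewrite mE; lia.
rewrite natr_sum mulr_suml scaler_suml; apply: eq_bigr => c _.
have [->|heavy] := posnP (n c - S); first by rewrite muln0 mul0r scale0r.
have nc : (S <= n c)%N by rewrite ltnW // -subn_gt0.
have nc0 : (S <= n c0)%N by rewrite -mc0 mE geq_minl.
have ccs : c \in cs.
  by rewrite -has_pred1 has_count (leq_trans heavy) // leq_subr.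
(* Here [0 < S]: a walk that occurs is nonempty and has length at most [S].
   Hence [c0], whose multiplicity is at least [S], occurs as well. *)
have zc : (0 < size c)%N.
  by have := allP acs c ccs; case: (val c).
have c0cs : c0 \in cs.
  by rewrite -has_pred1 has_count (leq_trans (leq_trans zc (size_bseq c))).
have zc0 : (size c0)%:R != 0 :> R.
  have := allP acs c0 c0cs; rewrite pnatr_eq0.
  by case: (val c0).
have := heavy_walks_parallel T1 vP sb acs ev eT ccs c0cs nc nc0.
rewrite -!scaler_nat => par.
rewrite natrM mulrAC [_ * (n c - S)%:R]mulrC -scalerA; congr (_ *: _).
by rewrite mulrC -scalerA -par scalerA mulVf // scale1r.
Qed.

End Vertices.

(** The decoding data form a finite type in which [T] does not appear, so its
    cardinal is a bound for all [T]. *)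
Theorem bounded_vertices (R : realType) (S : nat) :
  exists C : nat, forall T : nat, (1 < T)%N ->
    vertices (design_polytope R S T) #<= `I_C.
Proof.
pose D := ((S.+1 * S.+1).-bseq 'I_S * {ffun S.-bseq 'I_S -> 'I_S.+1})%type.
exists #|{: D}| => T T1.
apply: card_le_trans (subset_card_le (vertices_decoded T1)) _.
apply: card_le_trans (card_image_le _ _) _.
apply/pcard_leP/injfunPex.
exists (fun d : D => enum_rank d : nat) => [d _ /=|]; first exact: ltn_ord.
by move=> d d' _ _ /ord_inj/enum_rank_inj.
Qed.

Theorem theorem1p1 (R : realType) :
  exists C : nat, forall T : nat, (3 <= T)%N ->
    vertices (design_polytope R 3 T) #<= `I_C.
Proof.
have [C bound] := bounded_vertices R 3.
by exists C => T T3; apply: bound; apply: ltnW.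
Qed.
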